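(* Let $r\ge 2$ be an integer that is the order of some finite projective plane. Then \[ \lim_{q\to\infty}\frac{\operatorname{achr}(K_{r^2+r+1}\,\square\, K_q)}{q}=\frac{r^2+r+1}{r+1}. \]
   Context: A vertex colouring $f:V(G)\to C$ of a finite simple graph $G$ with a finite colour set $C$ is complete if for any two distinct colours $c_1,c_2\in C$ there are adjacent vertices $v_1,v_2$ with $f(v_1)=c_1$, $f(v_2)=c_2$. The achromatic number $\operatorname{achr}(G)$ is the maximum number of colours in a proper complete vertex colouring of $G$. The Cartesian product $G_1\square G_2$ has vertex set $V(G_1)\times V(G_2)$, with $(x_1,y_1)$ adjacent to $(x_2,y_2)$ iff either $x_1=x_2$ and $y_1y_2\in E(G_2)$, or $x_1x_2\in E(G_1)$ and $y_1=y_2$. For $r\ge2$, a finite projective plane of order $r$ is a pair $(P,\mathcal L)$ of a finite set $P$ of points and a set $\mathcal L$ of subsets of $P$ (lines) such that any two distinct points lie in exactly one common line, any two distinct lines intersect, there are four points no three of which lie on a common line, and some line has exactly $r+1$ points; $r$ is a finite projective plane order if such a plane exists. *)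

(* Defs.v *)
From mathcomp Require Import all_boot.

Set Implicit Arguments.
Unset Strict Implicit.
Unset Printing Implicit Defensive.

Record sgraph := SGraph {
  vertex :> finType;
  adj : rel vertex;
  adj_sym : symmetric adj;
  adj_irr : irreflexive adj }.

Section Colourings.
Variables (G : sgraph) (C : finType).

Definition proper_colouring (f : G -> C) : bool :=
  [forall x : G, forall y : G, adj x y ==> (f x != f y)].

Definition complete_colouring (f : G -> C) : bool :=
  [forall c1 : C, forall c2 : C, (c1 != c2) ==>
    [exists v1 : G, exists v2 : G,
      [&& adj v1 v2, f v1 == c1 & f v2 == c2]]].

End Colourings.

Definition has_complete_colouring (G : sgraph) (k : nat) : bool :=
  [exists f : {ffun G -> 'I_k}, proper_colouring f && complete_colouring f].

(* A complete colouring with at least two colours is surjective, so no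
   complete colouring has more than #|G| + 1 colours and the range below is
   large enough (the value #|G| + 1 is attained only by the graph without
   vertices, vacuously coloured by one colour); see achr_ge and achr_attained. *)
Definition achr (G : sgraph) : nat :=
  \max_(k < #|G|.+2 | has_complete_colouring G k) k.

Lemma complete_colouring_card (G : sgraph) (C : finType) (f : G -> C) :
  complete_colouring f -> #|C| <= #|G|.+1.
Proof.
move=> fC; have [C1|C2] := leqP #|C| 1; first exact: leq_trans C1 _.
apply: leqW.
have surj c : c \in codom f.
  have /card_gt0P[c'] : 0 < #|predC1 c| by rewrite cardC1 -subn1 subn_gt0.
  rewrite !inE eq_sym => cc'.
  move/forallP: fC => /(_ c)/forallP/(_ c')/implyP/(_ cc').
  by move=> /existsP[v /existsP[w /and3P[_ /eqP <- _]]]; exact: codom_f.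
apply: (@leq_trans #|codom f|); last exact: leq_image_card.
by apply: subset_leq_card; apply/subsetP => c _; exact: surj.
Qed.

Lemma has_complete_colouringP (G : sgraph) (k : nat) :
  reflect (exists (C : finType) (f : G -> C),
             [/\ #|C| = k, proper_colouring f & complete_colouring f])
          (has_complete_colouring G k).
Proof.
apply: (iffP existsP) => [[f /andP[fp fc]]|[C [f [<- fp fc]]]].
  by exists 'I_k, f; rewrite card_ord.
exists [ffun x => enum_rank (f x)]; apply/andP; split.
  apply/forallP => x; apply/forallP => y; rewrite !ffunE.
  by rewrite (inj_eq enum_rank_inj); move/forallP: fp => /(_ x)/forallP.
apply/forallP => c1; apply/forallP => c2; apply/implyP => c12.
move/forallP: fc => /(_ (enum_val c1))/forallP/(_ (enum_val c2))/implyP.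
rewrite (inj_eq enum_val_inj) => /(_ c12)/existsP[v /existsP[w]].
move=> /and3P[vw /eqP fv /eqP fw]; apply/existsP; exists v; apply/existsP.
by exists w; rewrite !ffunE vw fv fw !enum_valK !eqxx.
Qed.

Lemma achr_ge (G : sgraph) (C : finType) (f : G -> C) :
  proper_colouring f -> complete_colouring f -> #|C| <= achr G.
Proof.
move=> fp fc; have Clt : #|C| < #|G|.+2 by exact: complete_colouring_card fc.
apply: (@leq_bigmax_cond _ _ (fun k : 'I_#|G|.+2 => k : nat) (Ordinal Clt)).
by apply/has_complete_colouringP; exists C, f.
Qed.

Lemma achr_attained (G : sgraph) :
  exists (C : finType) (f : G -> C),
    [/\ #|C| = achr G, proper_colouring f & complete_colouring f].
Proof.
apply/has_complete_colouringP.
pose D := [pred k : 'I_#|G|.+2 | has_complete_colouring G k].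
suff D0 : 0 < #|D|.
  have [k kD Dk] := eq_bigmax_cond (fun k : 'I_#|G|.+2 => k : nat) D0.
  have -> : achr G = k by rewrite -Dk; apply: eq_bigl => j; rewrite inE.
  by move: kD; rewrite inE.
(* A proper colouring with the least number of colours is complete *)
pose A := [pred k : 'I_#|G|.+2 |
  [exists f : {ffun G -> 'I_k}, proper_colouring f]].
have nA : A (Ordinal (leqnSn #|G|.+1 : #|G| < #|G|.+2)).
  apply/existsP; exists [ffun x => enum_rank x].
  apply/forallP => x; apply/forallP => y; apply/implyP => xy; rewrite !ffunE.
  by rewrite (inj_eq enum_rank_inj); apply: contraTneq xy => ->; rewrite adj_irr.
case: (arg_minnP (fun k : 'I_#|G|.+2 => k : nat) nA) => k /existsP[f fp] kmin.
apply/card_gt0P; exists k; rewrite inE; apply/existsP; exists f.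
rewrite fp /=; apply/forallP => c1; apply/forallP => c2; apply/implyP => c12.
apply: contraT => nadj.
have adjF v w : adj v w -> ~~ ((f v == c1) && (f w == c2)).
  move=> vw; apply: contra nadj => vw12; apply/existsP; exists v.
  by apply/existsP; exists w; rewrite vw.
have k1 : #|predC1 c1| = k.-1 by rewrite cardC1 card_ord.
have k0 : 0 < k by exact: leq_ltn_trans (leq0n c1) (ltn_ord c1).
have c2P : c2 != c1 by rewrite eq_sym.
pose S := {c : 'I_k | c != c1}.
have cS : #|{: S}| = k.-1 by rewrite card_sig -k1; apply: eq_card.
pose g (v : G) : S := insubd (Sub c2 c2P : S) (f v).
have gE v : val (g v) = if f v == c1 then c2 else f v.
  by rewrite val_insubd; case: eqVneq.
have k1lt : k.-1 < #|G|.+2 by exact: leq_ltn_trans (leq_pred _) (ltn_ord k).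
(* merging c1 into c2 gives a proper colouring with one colour less *)
have : A (Ordinal k1lt).
  apply/existsP; exists [ffun x => cast_ord cS (enum_rank (g x))].
  apply/forallP => x; apply/forallP => y; apply/implyP => xy; rewrite !ffunE.
  rewrite (inj_eq (@cast_ord_inj _ _ _)) (inj_eq enum_rank_inj) -val_eqE !gE.
  have fxy : f x != f y by move/forallP: fp => /(_ x)/forallP/(_ y)/implyP; exact.
  have yx : adj y x by rewrite adj_sym.
  have := adjF _ _ xy; have := adjF _ _ yx; move: fxy.
  have [->|] := eqVneq (f x) c1; have [->|] := eqVneq (f y) c1; rewrite ?eqxx //=.
  by move=> _ _ _; rewrite eq_sym.
by move/kmin => /=; rewrite leqNgt ltn_predL k0.
Qed.

Section CompleteGraph.
Variable n : nat.

Definition complete_adj : rel 'I_n := fun x y => x != y.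

Lemma complete_adj_sym : symmetric complete_adj.
Proof. by move=> x y; rewrite /complete_adj eq_sym. Qed.

Lemma complete_adj_irr : irreflexive complete_adj.
Proof. by move=> x; rewrite /complete_adj eqxx. Qed.

Definition complete_graph : sgraph := SGraph complete_adj_sym complete_adj_irr.

End CompleteGraph.

Section CartesianProduct.
Variables G1 G2 : sgraph.

Definition cartesian_adj : rel (G1 * G2)%type := fun u v =>
  ((u.1 == v.1) && adj u.2 v.2) || (adj u.1 v.1 && (u.2 == v.2)).

Lemma cartesian_adj_sym : symmetric cartesian_adj.
Proof.
by move=> u v; rewrite /cartesian_adj (eq_sym v.1) (eq_sym v.2)
  (adj_sym v.1) (adj_sym v.2).
Qed.

Lemma cartesian_adj_irr : irreflexive cartesian_adj.
Proof. by move=> u; rewrite /cartesian_adj !adj_irr andbF. Qed.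

Definition cartesian_product : sgraph :=
  SGraph cartesian_adj_sym cartesian_adj_irr.

End CartesianProduct.

Definition projective_plane (r : nat) (P : finType) (L : {set {set P}}) : Prop :=
  [/\ forall x y : P, x != y ->
        exists! l : {set P}, [/\ l \in L, x \in l & y \in l],
      forall l m : {set P}, l \in L -> m \in L -> l != m -> l :&: m != set0,
      exists2 Q : {set P}, #|Q| = 4 &
        forall T l : {set P}, T \subset Q -> #|T| = 3 -> l \in L ->
          ~~ (T \subset l)
    & exists2 l : {set P}, l \in L & #|l| = r.+1 ].

Definition projective_plane_order (r : nat) : Prop :=
  exists (P : finType) (L : {set {set P}}), projective_plane r L.

(* Main.v *)
(** Let [n = r ^ 2 + r + 1].  In a complete colouring of [K_n □ K_q], either
every colour is used at least [r + 1] times, so that there are at most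
[n q / (r + 1)] colours, or some colour is used at most [r] times, and then all
other colours occur next to one of its occurrences, so that there are at most
[1 + r (n + q)] colours; since [r (r + 1) <= n], both bounds are
[n q / (r + 1) + O(1)].

Conversely, take the lines of a projective plane of order [r] as rows and [k]
copies of every point as colours, where [k] is about [q / (r + 1)].  A row
contains every copy of each of the [r + 1] points of its line exactly once, so
two colours always share the row of a line through their points.  Distinct
cyclic shifts of the copies in the rows keep the columns properly coloured. *)

Require Import Defs.
From mathcomp Require Import all_boot all_order all_algebra.
From mathcomp Require Import all_classical all_reals all_analysis.
From mathcomp Require Import zify ring lra.
Import Order.TTheory GRing.Theory Num.Theory.
Import numFieldNormedType.Exports.

Set Implicit Arguments.
Unset Strict Implicit.
Unset Printing Implicit Defensive.

(** * Upper bound: rare and frequent colours *)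

Section UpperBound.
Local Open Scope nat_scope.

Lemma complete_colouring_rare_colour (G : sgraph) (C : finType) (f : G -> C)
    (D : nat) (c : C) :
  complete_colouring f -> (forall v : G, #|[pred w | adj v w]| <= D) ->
  #|C| <= 1 + #|[pred v | f v == c]| * D.
Proof.
move=> fc degD.
have colours : [set: C] \subset
    c |: \bigcup_(v | f v == c) (f @: [set w | adj v w]).
  apply/fintype.subsetP => c' _; rewrite in_setU1; case: eqVneq => //= c'c.
  move/forallP: fc => /(_ c)/forallP/(_ c')/implyP; rewrite eq_sym => /(_ c'c).
  move=> /existsP[v /existsP[w /and3P[vw fv /eqP fw]]].
  by apply/bigcupP; exists v => //; rewrite -fw imset_f // inE.
rewrite -cardsT (leq_trans (subset_leq_card colours)) //.
rewrite (leq_trans (leq_card_setU _ _)) // cards1 leq_add2l.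
have le_sum : forall I (s : seq I) (F : I -> {set C}) (p : pred I),
    #|\bigcup_(i <- s | p i) F i| <= \sum_(i <- s | p i) #|F i|.
  move=> I s F p; apply: (big_rec2 (fun (A : {set C}) n => #|A| <= n)).
    by rewrite cards0.
  move=> i A n _ An.
  by rewrite (leq_trans (leq_card_setU _ _)) // leq_add2l.
rewrite (leq_trans (le_sum _ _ _ _)) // -sum_nat_const.
apply: leq_sum => v _; rewrite (leq_trans (leq_imset_card _ _)) //.
by rewrite cardsE; exact: degD.
Qed.

Lemma complete_colouring_frequent_colours (G : sgraph) (C : finType)
    (f : G -> C) (d : nat) :
  (forall c, d <= #|[pred v | f v == c]|) -> #|C| * d <= #|G|.
Proof.
move=> fd; rewrite -[#|G|]sum1_card (partition_big f predT) //=.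
by rewrite -sum_nat_const; apply: leq_sum => c _; rewrite sum1_card; exact: fd.
Qed.

Lemma cartesian_complete_degree (m q : nat)
    (v : cartesian_product (complete_graph m) (complete_graph q)) :
  #|[pred w | adj v w]| <= m + q.
Proof.
have nbh : [set w | adj v w] \subset
    [set (v.1, y) | y : 'I_q] :|: [set (x, v.2) | x : 'I_m].
  apply/fintype.subsetP => -[x y]; rewrite !inE /= /cartesian_adj /=.
  case/orP => /andP[].
    by move=> /eqP -> _; rewrite imset_f.
  by move=> _ /eqP ->; rewrite orbC imset_f.
rewrite -cardsE (leq_trans (subset_leq_card nbh)) //.
rewrite (leq_trans (leq_card_setU _ _)) // addnC.
by rewrite leq_add // (leq_trans (leq_imset_card _ _)) // card_ord.
Qed.

Lemma achr_cartesian_complete_le (m q d : nat) :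
  d * d.+1 <= m ->
  achr (cartesian_product (complete_graph m) (complete_graph q)) * d.+1
    <= m * q + d.+1 * (1 + d * m).
Proof.
move=> dm; have [C [f [<- _ fc]]] :=
  achr_attained (cartesian_product (complete_graph m) (complete_graph q)).
have [/forallP fd|/forallPn[c]] :=
  boolP [forall c, d.+1 <= #|[pred v | f v == c]|].
  apply: leq_trans (complete_colouring_frequent_colours fd) _.
  by rewrite card_prod !card_ord leq_addr.
rewrite -leqNgt => cd.
have := complete_colouring_rare_colour c fc (@cartesian_complete_degree m q).
move=> /leq_trans - /(_ (1 + d * (m + q))).
(* The rare colour gives the bound [1 + d * (m + q)]; multiplied by [d.+1], its term in [q] is
   absorbed by [m * q] because [d * d.+1 <= m]. *)
by rewrite leq_add2l leq_mul2r cd orbT => /(_ isT); nia.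
Qed.

End UpperBound.

(** * Lower bound: a colouring from pairwise joined points *)

Section LowerBound.
Local Open Scope nat_scope.
Variables (m d k t : nat) (P : finType) (B : 'I_m -> {set P}).
Hypothesis card_B : forall i, #|B i| = d.
Hypothesis joined : forall x y, exists2 i, x \in B i & y \in B i.
Hypothesis proper_B : forall i, exists x, x \notin B i.
(** [mk] makes the shifts by the row number distinct modulo [k]; [tk] provides enough copies for all
    vertices in the last [t] columns to get different ones. *)
Hypotheses (mk : m <= k) (tk : t * m <= k) (m_gt0 : 0 < m).

Let k_gt0 : 0 < k. Proof. exact: leq_trans m_gt0 mk. Qed.

Let z i := xchoose (proper_B i).

(* The last [t] columns reuse colours: in row [i] they receive copies of a
   point outside [B i], no copy being used twice. *)
Let f (v : 'I_m * 'I_(d * k + t)) : P * 'I_k :=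
  if v.2 < d * k
  then (nth (z v.1) (enum (B v.1)) (v.2 %/ k),
        Ordinal (ltn_pmod (v.2 %% k + v.1) k_gt0))
  else (z v.1, Ordinal (ltn_pmod ((v.2 - d * k) * m + v.1) k_gt0)).

Let G := cartesian_product (complete_graph m) (complete_graph (d * k + t)).

Let size_B i : size (enum (B i)) = d. Proof. by rewrite -cardE. Qed.

Let f_in (i : 'I_m) (c : 'I_(d * k + t)) : (f (i, c)).1 \in B i = (c < d * k).
Proof.
rewrite /f /=; case: ifP => /= ck; last exact/negbTE/(xchooseP (proper_B i)).
by rewrite -mem_enum mem_nth // size_B ltn_divLR.
Qed.

Let eq_modD a b c : a < k -> b < k -> (a + c) %% k = (b + c) %% k -> a = b.
Proof.
by move=> ak bk /eqP; rewrite eqn_modDr !modn_small // => /eqP.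
Qed.

(** Hence the reduction modulo [k] in [f] is void on the last [t] columns, where the copy number
    encodes column and row injectively. *)
Let leftover_lt (i : 'I_m) (c : 'I_(d * k + t)) :
  d * k <= c -> (c - d * k) * m + i < k.
Proof.
move=> dc; apply: leq_trans tk.
have ct : (c - d * k).+1 <= t by have := ltn_ord c; lia.
apply: leq_trans (leq_mul ct (leqnn m)).
by rewrite mulSn addnC ltn_add2r.
Qed.

Let proper_f : @proper_colouring G (P * 'I_k)%type f.
Proof.
apply/forallP => -[i c]; apply/forallP => -[j e]; apply/implyP => /= ij.
apply/eqP => fE; move: ij; rewrite /cartesian_adj /=.
have := congr1 (fun u => nat_of_ord u.2) fE; have := congr1 fst fE.
move=> fE1 fE2; case/orP => /andP[].
  (* Same row: by [f_in] the colour tells which kind of column it stands in; quotient and remainder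
     by [k] then determine the column. *)
  move=> /eqP ij; subst j; apply/negP; rewrite negbK; apply/eqP/val_inj => /=.
  have ce : (c < d * k) = (e < d * k) by rewrite -(f_in i) fE1 f_in.
  move: fE1 fE2; rewrite /f /= -ce; case: ifP => /= ck; last first.
    have dc : d * k <= c by rewrite leqNgt ck.
    have de : d * k <= e by rewrite leqNgt -ce ck.
    move=> _; rewrite !modn_small ?leftover_lt // => /addIn/eqP.
    by rewrite eqn_mul2r -leqn0 leqNgt m_gt0 /= => /eqP; lia.
  have ek : e < d * k by rewrite -ce.
  move=> /eqP; rewrite nth_uniq ?size_B ?ltn_divLR ?enum_uniq // => /eqP ce1.
  move=> /eq_modD; rewrite !ltn_pmod // => /(_ isT isT) ce2.
  by rewrite (divn_eq c k) (divn_eq e k) ce1 ce2.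
(* Same column: the copy number alone determines the row. *)
move=> ij /eqP ce; subst e; move/negP: ij; apply; apply/eqP/val_inj => /=.
move: fE2; rewrite /f /=; case: ifP => /= ck.
  rewrite ![_ %% k + _]addnC => /eq_modD.
  by apply; apply: leq_trans (ltn_ord _) mk.
have dc : d * k <= c by rewrite leqNgt ck.
by rewrite !modn_small ?leftover_lt // => /addnI.
Qed.

Let f_onto (i : 'I_m) x (a : 'I_k) :
  x \in B i -> exists c : 'I_(d * k + t), f (i, c) = (x, a).
Proof.
(* [s] is [a - i] modulo [k], which undoes the shift of row [i]; the truncated [k - i] is exact
   since [i < m <= k]. *)
move=> xB; pose s := (a + (k - i)) %% k.
have sk : s < k by exact: ltn_pmod.
have id : index x (enum (B i)) < d by rewrite -(size_B i) index_mem mem_enum.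
have cd : index x (enum (B i)) * k + s < d * k.
  by apply: leq_trans (leq_mul id (leqnn k)); rewrite mulSn addnC ltn_add2r.
exists (Ordinal (ltn_addr t cd)); rewrite /f /= cd; congr pair.
  by rewrite divnMDl // divn_small // addn0 nth_index // mem_enum.
apply/val_inj => /=; rewrite modnMDl modn_mod modnDml -addnA subnK.
  by rewrite modnDr modn_small.
by apply: leq_trans mk; exact/ltnW.
Qed.

Let complete_f : @complete_colouring G (P * 'I_k)%type f.
Proof.
apply/forallP => -[x a]; apply/forallP => -[y b]; apply/implyP => xyab.
(* The case [x = y] is included: two copies of one point also need a common row. *)
have [i xi yi] := joined x y.
have [c fc] := f_onto a xi; have [e fe] := f_onto b yi.
apply/existsP; exists (i, c); apply/existsP; exists (i, e).
rewrite fc fe !eqxx /= /cartesian_adj /= eqxx /= !andbT.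
apply/orP; left; apply/eqP => ce; move: xyab; rewrite -fc -fe ce.
by rewrite eqxx.
Qed.

Lemma achr_cartesian_complete_ge : #|P| * k <= achr G.
Proof. by have := achr_ge proper_f complete_f; rewrite card_prod card_ord. Qed.

End LowerBound.

(** * Counting points and lines of a projective plane *)

Section ProjectivePlane.
Local Open Scope nat_scope.
Variables (r : nat) (P : finType) (L : {set {set P}}).
Hypothesis plane : projective_plane r L.

Let join_line x y :
  x != y -> exists l : {set P}, [/\ l \in L, x \in l & y \in l].
Proof. by case: plane => J _ _ _ /J[l [lP _]]; exists l. Qed.

Let eq_line x y (l m : {set P}) : x != y -> l \in L -> m \in L ->
  x \in l -> y \in l -> x \in m -> y \in m -> l = m.
Proof.
case: plane => J _ _ _ /J[l' [_ U]] lL mL xl yl xm ym.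
by rewrite -(U l) // -(U m).
Qed.

Let meet_line (l m : {set P}) :
  l \in L -> m \in L -> l != m -> exists2 x, x \in l & x \in m.
Proof.
case: plane => _ M _ _ lL mL lm; have /set0Pn[x] := M l m lL mL lm.
by rewrite inE => /andP[]; exists x.
Qed.

Let pencil x := [set l in L | x \in l].

(** Joining [x] to the points of [l] is a bijection from [l] onto the pencil of [x]. *)
Lemma card_pencil x (l : {set P}) :
  l \in L -> x \notin l -> #|pencil x| = #|l|.
Proof.
move=> lL xl.
(* The guard [y != x] makes the claim total in [y], so that [choice] yields a function [g]. *)
have join y : exists l' : {set P}, y != x -> [/\ l' \in L, x \in l' & y \in l'].
  have [->|yx] := eqVneq y x; first by exists l.
  by rewrite eq_sym in yx; have [l' l'P] := join_line yx; exists l'.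
have [g gP] := choice join.
have yx y : y \in l -> y != x by apply: contraTneq => ->.
rewrite -(card_in_imset (f := g) (D := mem l)).
  congr #|pred_of_set _|; apply/setP => m; rewrite inE; apply/andP/imsetP.
    move=> [mL xm]; have ml : m != l by apply: contraNneq xl => <-.
    have [y ym yl] := meet_line mL lL ml; exists y => //.
    have [gL xg yg] := gP y (yx y yl).
    exact: eq_line (yx y yl) mL gL ym xm yg xg.
  by move=> [y yl ->]; have [gL xg _] := gP y (yx y yl).
move=> y y' yl y'l gg; have [gL xg yg] := gP y (yx y yl).
have [_ _ yg'] := gP y' (yx y' y'l); rewrite -gg in yg'.
apply/eqP; apply: contraT => yy'.
by move: xl; rewrite (eq_line yy' lL gL yl y'l yg yg') xg.
Qed.

(** This allows two lines to be compared through the pencil of a point on neither. If [l] and [m]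
    cover the quadrangle [Q], they contain two of its points each, and a diagonal point serves. *)
Lemma point_off_two_lines (l m : {set P}) : l \in L -> m \in L ->
  exists x, (x \notin l) && (x \notin m).
Proof.
move=> lL mL; case: plane => _ _ [Q Q4 Qgen] _.
have small h : h \in L -> #|Q :&: h| <= 2.
  move=> hL; rewrite leqNgt; apply/negP => Qh3.
  have /card_gt0P[T] : 0 < #|[set T : {set P} | T \subset Q :&: h & #|T| == 3]|.
    by rewrite cards_draws bin_gt0.
  rewrite inE finset.subsetI => /andP[/andP[TQ Th] /eqP T3].
  by move: (Qgen T h TQ T3 hL); rewrite Th.
have noncol x y w h : x \in Q -> y \in Q -> w \in Q -> h \in L ->
    x != y -> x != w -> y != w -> x \in h -> y \in h -> w \in h -> False.
  move=> xQ yQ wQ hL xy xw yw xh yh wh; have := small h hL.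
  rewrite leqNgt => /negP; apply.
  have : uniq [:: x; y; w] by rewrite /= !inE negb_or xy xw yw.
  move=> /card_uniqP /= <-; apply: subset_leq_card; apply/fintype.subsetP => u.
  by rewrite !inE => /or3P[] /eqP ->; apply/andP.
have [/existsP //|/existsPn off] :=
  boolP [exists x, (x \notin l) && (x \notin m)].
have cover x : (x \in l) || (x \in m).
  by have := off x; rewrite negb_and !negbK.
have QE : Q = (Q :&: l) :|: (Q :&: m).
  by apply/setP => x; rewrite !inE -andb_orr cover andbT.
(* Both summands on the left are at most 2, so each is 2 and the intersection on the right is
   empty. *)
have cQ : #|Q :&: l| + #|Q :&: m| = #|(Q :&: l) :&: (Q :&: m)| + 4.
  by rewrite -cardsUI -QE Q4 addnC.
have [l2 m2] := (small l lL, small m mL).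
have /eqP/cards2P[a [b [ab QlE]]] : #|Q :&: l| = 2 by lia.
have /eqP/cards2P[c [e [ce QmE]]] : #|Q :&: m| = 2 by lia.
have /eqP : #|(Q :&: l) :&: (Q :&: m)| = 0 by lia.
rewrite cards_eq0 => /eqP/setP lm0.
have /setIP[aQ al] : a \in Q :&: l by rewrite QlE !inE eqxx.
have /setIP[bQ bl] : b \in Q :&: l by rewrite QlE !inE eqxx orbT.
have /setIP[cQ' cm] : c \in Q :&: m by rewrite QmE !inE eqxx.
have /setIP[eQ em] : e \in Q :&: m by rewrite QmE !inE eqxx orbT.
have ne x y : x \in Q -> y \in Q -> x \in l -> y \in m -> x != y.
  move=> xQ _ xl ym; apply/eqP => xy; have := lm0 x.
  by rewrite !inE xQ xl xy ym.
(* The diagonal point [ac ∩ be] of the quadrangle is on neither line. *)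
have [ac ae bc be] : [/\ a != c, a != e, b != c & b != e] by rewrite !ne.
have [h [hL ah ch]] := join_line ac; have [h' [hL' bh eh]] := join_line be.
have hh : h != h'.
  by apply/eqP => hh; rewrite hh in ah; apply: (noncol a b e h').
have [x xh xh'] := meet_line hL hL' hh.
exists x; apply/andP; split; apply/negP => xlm.
  have [ax|ax] := eqVneq a x.
    by rewrite -ax in xh'; apply: (noncol a b e h').
  have lh : l = h by apply: eq_line ax lL hL al xlm ah xh.
  by rewrite -lh in ch; apply: (noncol a b c l).
have [cx|cx] := eqVneq c x.
  by rewrite -cx in xh'; apply: (noncol b c e h').
have mh : m = h by apply: eq_line cx mL hL cm xlm ch xh.
by rewrite -mh in ah; apply: (noncol a c e m).
Qed.

Lemma card_line (l : {set P}) : l \in L -> #|l| = r.+1.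
Proof.
case: plane => _ _ _ [l0 l0L <-] lL.
have [x /andP[xl xl0]] := point_off_two_lines lL l0L.
by rewrite -(card_pencil lL xl) -(card_pencil l0L xl0).
Qed.

Lemma card_lines_through x : #|pencil x| = r.+1.
Proof.
case: plane => _ _ _ [l0 l0L _].
have [y /andP[yl0 _]] := point_off_two_lines l0L l0L.
have [xl0|/card_pencil -> //] := boolP (x \in l0); last exact: card_line.
(* It remains to find a line missing [x]: with [h] the line [xy] and [w] off [h], the line [wy]
   meets [h] only in [y]. *)
have yx : y != x by apply: contraNneq yl0 => ->.
have [h [hL yh xh]] := join_line yx.
have [w /andP[wl0 wh]] := point_off_two_lines l0L hL.
have wy : w != y by apply: contraNneq wh => ->.
have [h' [h'L wh' yh']] := join_line wy.
have xh' : x \notin h'.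
  apply/negP => xh'; move: wh.
  by rewrite (eq_line yx hL h'L yh xh yh' xh') wh'.
by rewrite (card_pencil h'L xh') card_line.
Qed.

(** Every point other than [x] is on exactly one of the [r.+1] lines through [x], each of which has
    [r] further points. *)
Lemma card_points : #|P| = r ^ 2 + r + 1.
Proof.
case: plane => _ _ _ [l0 l0L l0r].
have [x _] : exists x, x \in l0 by apply/set0Pn; rewrite -card_gt0 l0r.
have others : \sum_(y : P | y != x) 1 = \sum_(l in pencil x) r.
  transitivity (\sum_(y | y != x) \sum_(l in pencil x | y \in l) 1).
    apply: eq_bigr => y yx; have xy : x != y by rewrite eq_sym.
    have [l [lL xl yl]] := join_line xy.
    rewrite (big_pred1 l) // => m; rewrite !inE.
    apply/andP/eqP => [[/andP[mL xm] ym]|->]; last by rewrite lL xl.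
    exact: eq_line xy mL lL xm ym xl yl.
  rewrite (exchange_big_dep (mem (pencil x))) //=; last first.
    by move=> y l _ /andP[].
  apply: eq_bigr => l; rewrite inE => /andP[lL xl].
  rewrite sum1_card; have := card_line lL; rewrite (cardsD1 x) xl => -[<-].
  by rewrite -sum1_card -sum1_card; apply: eq_bigl => y; rewrite !inE lL.
move: others; rewrite sum1_card sum_nat_const card_lines_through.
have -> : #|[pred y | y != x]| = #|P|.-1 by rewrite -(cardC1 x); apply: eq_card.
have : 0 < #|P| by apply/card_gt0P; exists x.
by rewrite -mulnn; nia.
Qed.

(** Double counting of incidences: [r.+1] points per line and [r.+1] lines per point. *)
Lemma card_lines : #|L| = r ^ 2 + r + 1.
Proof.
rewrite -card_points; apply/eqP; rewrite -(eqn_pmul2r (ltn0Sn r)); apply/eqP.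
transitivity (\sum_(l in L) \sum_(x in l) 1).
  rewrite -sum_nat_const; apply: eq_bigr => l lL.
  by rewrite sum1_card card_line.
rewrite (exchange_big_dep predT) //= -sum_nat_const; apply: eq_bigr => x _.
by rewrite -(card_lines_through x) -sum1_card; apply: eq_bigl => l; rewrite inE.
Qed.

Lemma line_through_two_points x y :
  exists l : {set P}, [/\ l \in L, x \in l & y \in l].
Proof.
have [->|/join_line //] := eqVneq x y.
have /card_gt0P[l] : 0 < #|pencil y| by rewrite card_lines_through.
by rewrite inE => /andP[lL yl]; exists l.
Qed.

End ProjectivePlane.

(** * Both bounds up to a constant, and the limit *)

Section Asymptotics.
Local Open Scope nat_scope.

(** The construction is used with [k = q %/ r.+1] and [t = q %% r.+1]; the error [m * r] comes from
    [t <= r]. *)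
Lemma achr_projective_plane_ge (r q : nat) :
  projective_plane_order r ->
  let m := r ^ 2 + r + 1 in
  r.+1 * m <= q %/ r.+1 ->
  m * q <= achr (cartesian_product (complete_graph m) (complete_graph q))
             * r.+1 + m * r.
Proof.
move=> [P [L plane]] m q_large.
have Lm : m = #|L| by rewrite (card_lines plane).
pose B (i : 'I_m) := enum_val (cast_ord Lm i).
have BL i : B i \in L by exact: enum_valP.
have card_B i : #|B i| = r.+1 by exact: card_line plane _ (BL i).
have joined x y : exists2 i, x \in B i & y \in B i.
  have [l [lL xl yl]] := line_through_two_points plane x y.
  have BE : B (cast_ord (esym Lm) (enum_rank_in lL l)) = l.
    by rewrite /B cast_ordKV enum_rankK_in.
  by exists (cast_ord (esym Lm) (enum_rank_in lL l)); rewrite BE.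
have proper_B i : exists x, x \notin B i.
  have [x /andP[xB _]] := point_off_two_lines plane (BL i) (BL i).
  by exists x.
have m_gt0 : 0 < m by rewrite /m addn1.
have rq : q %% r.+1 < r.+1 by rewrite ltn_pmod.
have mk : m <= q %/ r.+1 by apply: leq_trans q_large; rewrite leq_pmull.
have tk : q %% r.+1 * m <= q %/ r.+1.
  by apply: leq_trans q_large; rewrite leq_mul2r ltnW ?orbT.
have := achr_cartesian_complete_ge card_B joined proper_B mk tk m_gt0.
rewrite [_.+1 * _]mulnC -divn_eq (card_points plane) -/m => lower.
have := leq_mul lower (leqnn r.+1); rewrite -mulnA; have := divn_eq q r.+1.
by move: (achr _) (_ %/ _) (_ %% _) rq => A a b rq -> lowr; nia.
Qed.

End Asymptotics.

Local Open Scope classical_set_scope.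
Local Open Scope ring_scope.

Lemma cvg_ratio_bounded_error (R : realType) (u : nat -> nat) (a d K N : nat) :
  (0 < d)%N ->
  (forall q, (N <= q)%N -> (a * q <= u q * d + K)%N) ->
  (forall q, (N <= q)%N -> (u q * d <= a * q + K)%N) ->
  (fun q => (u q)%:R / q%:R : R) @ \oo --> (a%:R / d%:R : R).
Proof.
move=> d_gt0 lo up; have dR : 0 < d%:R :> R by rewrite ltr0n.
apply/cvgrPdist_le => e e_gt0.
near=> q.
have q_gt0 : (0 < q)%N by near: q; exists 1%N.
have Nq : (N <= q)%N by near: q; exists N.
have qR : 0 < q%:R :> R by rewrite ltr0n.
(* The distance to the limit is at most [K / (d q)], so [q >= K / e] suffices, as [d >= 1]. *)
have Kq : K%:R / e <= q%:R :> R.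
  by near: q; exact: nbhs_infty_ger.
have {}Kq : K%:R <= e * q%:R :> R by rewrite mulrC -ler_pdivrMr.
have -> : a%:R / d%:R - (u q)%:R / q%:R =
    (a%:R * q%:R - (u q)%:R * d%:R) / (d%:R * q%:R) :> R.
  by field; rewrite !gt_eqF.
have dq : 0 < d%:R * q%:R :> R by rewrite mulr_gt0.
rewrite normrM normfV (gtr0_norm dq) ler_pdivrMr //.
have := lo q Nq; have := up q Nq; rewrite -2!(ler_nat R) !natrD !natrM => U L.
have eq : e * q%:R <= e * (d%:R * q%:R).
  by rewrite ler_pM2l // ler_peMl ?ler1n // ltW.
by rewrite ler_norml; apply/andP; split; lra.
Unshelve. all: by end_near.
Qed.

Theorem theorem4p1 (R : realType) (r : nat) (hr : (2 <= r)%N)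
    (hplane : projective_plane_order r) :
  (fun q : nat =>
     (achr (cartesian_product (complete_graph (r ^ 2 + r + 1))
                              (complete_graph q)))%:R / q%:R : R) @ \oo
    --> ((r ^ 2 + r + 1)%N%:R / (r + 1)%N%:R : R).
Proof.
rewrite [(r + 1)%N]addn1; set m := (r ^ 2 + r + 1)%N.
(* [K] adds the error terms of the two bounds; the threshold [r.+1 * m * r.+1] used next is what
   [r.+1 * m <= q %/ r.+1] requires. *)
pose K := (m * r + r.+1 * (1 + r * m))%N.
apply: (@cvg_ratio_bounded_error R _ _ _ K (r.+1 * m * r.+1)%N) => // q qN.
  have q_large : (r.+1 * m <= q %/ r.+1)%N by rewrite leq_divRL.
  apply: leq_trans (achr_projective_plane_ge hplane q_large) _.
  by rewrite leq_add2l leq_addr.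
have rm : (r * r.+1 <= m)%N by rewrite /m -mulnn mulnS; lia.
apply: leq_trans (achr_cartesian_complete_le q rm) _.
by rewrite leq_add2l leq_addl.
Qed.
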